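(* Let $N\ge1$ and let $A\in M_N(\mathbb{C})$ be such that $\sigma(A)\subset W(A)^\circ$. If $A_n\to A$ in $M_N(\mathbb{C})$, then $\limsup_{n\to\infty}\psi(A_n)\le\psi(A)$.
   Context: $M_N(\mathbb{C})$ denotes the algebra of complex $N\times N$ matrices acting on $\mathbb{C}^N$ with the Euclidean inner product, equipped with the operator norm. $\sigma(A)$ is the spectrum (set of eigenvalues) of $A$. The numerical range is $W(A):=\{\langle Ax,x\rangle: x\in\mathbb{C}^N,\ \|x\|=1\}$, and $W(A)^\circ$ denotes its interior in $\mathbb{C}$. The Crouzeix ratio of $A$ is $\psi(A):=\sup\{\|p(A)\|: p \text{ a polynomial with } |p|\le 1 \text{ on } W(A)\}$. *)

(* Defs.v *)
From HB Require Import structures.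
From mathcomp Require Import all_boot all_order all_algebra.
From mathcomp Require Import all_classical all_reals all_analysis.
From mathcomp Require Import complex.
Set Implicit Arguments. Unset Strict Implicit. Unset Printing Implicit Defensive.
Import Order.TTheory GRing.Theory Num.Theory.
Local Open Scope ring_scope.
Local Open Scope classical_set_scope.

Section Crouzeix.
Variable R : realType.
Local Notation C := R[i].

Definition cmod (z : C) : R := Normc.normc z.

Definition vnorm (n : nat) (x : 'cV[C]_n) : R :=
  Num.sqrt (\sum_i cmod (x i 0) ^+ 2).

Definition cinner (n : nat) (x y : 'cV[C]_n) : C :=
  \sum_i x i 0 * (y i 0)^*.

Definition opnorm (n : nat) (A : 'M[C]_n) : R :=
  sup [set vnorm (A *m x) | x in [set x : 'cV[C]_n | vnorm x = 1]].

Definition numrange (n : nat) (A : 'M[C]_n) : set C :=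
  [set z | exists x : 'cV[C]_n, vnorm x = 1 /\ z = cinner (A *m x) x].

Definition cinterior (S : set C) : set C :=
  [set z | exists e : R, 0 < e /\ forall w : C, cmod (w - z) < e -> S w].

Definition spectrum (n : nat) (A : 'M[C]_n) : set C :=
  [set z | eigenvalue A z].

Definition crouzeix_ratio (n : nat) (A : 'M[C]_n.+1) : \bar R :=
  ereal_sup [set (opnorm (horner_mx A p))%:E |
     p in [set p : {poly C} | forall z, numrange A z -> cmod p.[z] <= 1]].

End Crouzeix.

(* Main.v *)
Require Import Defs.
From HB Require Import structures.
From mathcomp Require Import all_boot all_order all_algebra all_solvable all_field.
From mathcomp Require Import all_classical all_reals all_analysis.
From mathcomp Require Import complex ring lra zify.
Import Order.TTheory GRing.Theory Num.Theory numFieldNormedType.Exports.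
Local Open Scope ring_scope.
Local Open Scope classical_set_scope.
Set Implicit Arguments. Unset Strict Implicit. Unset Printing Implicit Defensive.

(* Let [A_n -> A], let [p] be admissible for [A_n], let [z0] be an eigenvalue of
   [A] and let [p_t] be [p] composed with the contraction [(1 - t) X + t z0].  By
   convexity of the numerical range (Toeplitz-Hausdorff) this contraction maps
   [W(A)] into [W(A_n)] for [n] large, so [p_t] is admissible for [A] and
   [||p((1 - t) A + t z0)|| <= psi(A)].  It remains to compare [p] at the two
   matrices [A_n] and [(1 - t) A + t z0], both close to [A], uniformly in [p].
   Near the eigenvalues of [A] one has [|p| <= 1]; dividing [p] repeatedly by the
   linear factors of the characteristic polynomial of [A] and controlling the
   quotients by the maximum principle shows that [B |-> p(B)] is Lipschitz near
   [A], with a constant independent of [p].  This replaces normal families and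
   Runge's theorem. *)

(** * Modulus, Euclidean norm and operator norm *)

Section Norms.
Variable R : realType.
Local Notation C := R[i].
Implicit Types z w : C.

Lemma cmod_normE z : `|z| = (cmod z)%:C%C.
Proof. by []. Qed.

Lemma cmod_ge0 z : 0 <= cmod z.
Proof. by have := normr_ge0 z; rewrite cmod_normE ler0c. Qed.

Lemma cmodM z w : cmod (z * w) = cmod z * cmod w.
Proof. exact: Normc.normcM. Qed.

Lemma cmodX z k : cmod (z ^+ k) = cmod z ^+ k.
Proof.
elim: k => [|k IH]; first exact: Normc.normc1.
by rewrite !exprS cmodM IH.
Qed.

Lemma cmodV z : cmod z^-1 = (cmod z)^-1.
Proof. exact: Normc.normcV. Qed.

Lemma cmodD z w : cmod (z + w) <= cmod z + cmod w.
Proof. exact: le_normcD. Qed.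

Lemma cmodN z : cmod (- z) = cmod z.
Proof. exact: normcN. Qed.

Lemma cmodB z w : cmod (z - w) <= cmod z + cmod w.
Proof. by rewrite -(cmodN w) cmodD. Qed.

Lemma cmod0 : cmod (0 : C) = 0.
Proof. exact: Normc.normc0. Qed.

Lemma cmod1 : cmod (1 : C) = 1.
Proof. exact: Normc.normc1. Qed.

Lemma cmod_eq0 z : (cmod z == 0) = (z == 0).
Proof.
by apply/eqP/eqP => [/Normc.eq0_normc//|->]; rewrite cmod0.
Qed.

Lemma cmod_real (x : R) : cmod x%:C%C = `|x|.
Proof. by rewrite /cmod /= expr0n addr0 sqrtr_sqr. Qed.

Lemma cmod_realp (x : R) : 0 <= x -> cmod x%:C%C = x.
Proof. by move=> x0; rewrite cmod_real ger0_norm. Qed.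

Lemma cmod_sqr z : cmod z ^+ 2 = complex.Re z ^+ 2 + complex.Im z ^+ 2.
Proof. by case: z => a b /=; rewrite sqr_sqrtr ?addr_ge0 ?sqr_ge0. Qed.

Lemma cmod_conj z : cmod z^* = cmod z.
Proof.
by apply: (@complexI R); rewrite -!cmod_normE norm_conjC.
Qed.

Lemma mulc_conj z : z * z^* = (cmod z ^+ 2)%:C%C.
Proof. by rewrite -normCK cmod_normE rmorphXn. Qed.

Lemma cmod_Re z : `|complex.Re z| <= cmod z.
Proof.
rewrite -(@ler_pXn2r _ 2) ?nnegrE ?cmod_ge0 // cmod_sqr real_normK ?num_real //.
by rewrite lerDl sqr_ge0.
Qed.

Lemma cmod_Im z : `|complex.Im z| <= cmod z.
Proof.
rewrite -(@ler_pXn2r _ 2) ?nnegrE ?cmod_ge0 // cmod_sqr real_normK ?num_real //.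
by rewrite lerDr sqr_ge0.
Qed.

Lemma cmod_sum (I : Type) (s : seq I) (P : pred I) (F : I -> C) :
  cmod (\sum_(i <- s | P i) F i) <= \sum_(i <- s | P i) cmod (F i).
Proof.
elim/big_rec2: _ => [|i x y _ le]; first by rewrite cmod0.
by rewrite (le_trans (cmodD _ _)) // lerD2l.
Qed.

Section Vectors.
Variable n : nat.
Implicit Types x y : 'cV[C]_n.

Lemma vnorm_ge0 x : 0 <= vnorm x.
Proof. exact: sqrtr_ge0. Qed.

Lemma vnorm_sqr x : vnorm x ^+ 2 = \sum_i cmod (x i 0) ^+ 2.
Proof. by rewrite sqr_sqrtr // sumr_ge0 // => i _; rewrite sqr_ge0. Qed.

Lemma vnorm0 : vnorm (0 : 'cV[C]_n) = 0.
Proof.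
rewrite /vnorm big1 ?sqrtr0 // => i _.
by rewrite mxE cmod0 expr0n.
Qed.

Lemma vnormZ c x : vnorm (c *: x) = cmod c * vnorm x.
Proof.
apply/eqP; rewrite -(@eqrXn2 _ 2) ?mulr_ge0 ?vnorm_ge0 ?cmod_ge0 //.
rewrite exprMn !vnorm_sqr mulr_sumr; apply/eqP/eq_bigr => i _.
by rewrite mxE cmodM exprMn.
Qed.

Lemma cmod_coord_le x i : cmod (x i 0) <= vnorm x.
Proof.
rewrite -(@ler_pXn2r _ 2) ?nnegrE ?cmod_ge0 ?vnorm_ge0 // vnorm_sqr.
by rewrite (bigD1 i) //= lerDl sumr_ge0 // => j _; rewrite sqr_ge0.
Qed.

Lemma vnorm_eq0 x : (vnorm x == 0) = (x == 0).
Proof.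
apply/eqP/eqP => [x0|->]; last exact: vnorm0.
apply/matrixP => i j; rewrite ord1 mxE; apply/eqP.
by rewrite -cmod_eq0 eq_le cmod_ge0 andbT -x0 cmod_coord_le.
Qed.

Lemma vnormN x : vnorm (- x) = vnorm x.
Proof. by rewrite -scaleN1r vnormZ cmodN cmod1 mul1r. Qed.

(* Convexity of the square gives the triangle inequality after weighting the
   coordinates by the two norms. *)
Lemma vnormD x y : vnorm (x + y) <= vnorm x + vnorm y.
Proof.
have [->|x0] := eqVneq x 0; first by rewrite vnorm0 !add0r.
have [->|y0] := eqVneq y 0; first by rewrite vnorm0 !addr0.
have a0 : 0 < vnorm x by rewrite lt_neqAle vnorm_ge0 eq_sym vnorm_eq0 x0.
have b0 : 0 < vnorm y by rewrite lt_neqAle vnorm_ge0 eq_sym vnorm_eq0 y0.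
have ab0 := addr_gt0 a0 b0.
rewrite -(@ler_pXn2r _ 2) ?nnegrE ?vnorm_ge0 ?(ltW ab0) // vnorm_sqr.
set a := vnorm x in a0 ab0 *; set b := vnorm y in b0 ab0 *.
have -> : (a + b) ^+ 2 =
    \sum_i (a + b) * (cmod (x i 0) ^+ 2 / a + cmod (y i 0) ^+ 2 / b).
  rewrite -mulr_sumr big_split /= -!mulr_suml -!vnorm_sqr -/a -/b.
  by field; rewrite !gt_eqF.
apply: ler_sum => i _; rewrite mxE.
have := cmodD (x i 0) (y i 0).
move: (cmod_ge0 (x i 0 + y i 0)) (cmod_ge0 (x i 0)) (cmod_ge0 (y i 0)).
move: (cmod (_ + _)) (cmod (x i 0)) (cmod (y i 0)) => r s t r0 s0 t0 rst.
apply: (@le_trans _ _ ((s + t) ^+ 2)).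
  by rewrite ler_pXn2r ?nnegrE ?addr_ge0.
rewrite -subr_ge0.
have -> : (a + b) * (s ^+ 2 / a + t ^+ 2 / b) - (s + t) ^+ 2
  = (b * s - a * t) ^+ 2 / (a * b).
  by field; rewrite !gt_eqF.
by rewrite divr_ge0 ?sqr_ge0 // mulr_ge0 ?ltW.
Qed.

Lemma vnorm_normalize x : x != 0 -> vnorm ((vnorm x)^-1%:C%C *: x) = 1.
Proof.
move=> x0; rewrite vnormZ cmod_realp ?invr_ge0 ?vnorm_ge0 // mulVf //.
by rewrite vnorm_eq0.
Qed.

Lemma cinnerC x y : cinner x y = (cinner y x)^*.
Proof.
rewrite /cinner raddf_sum; apply: eq_bigr => i _ /=.
by rewrite rmorphM /= conjCK mulrC.
Qed.

Lemma cinnerDl x y (z : 'cV[C]_n) : cinner (x + y) z = cinner x z + cinner y z.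
Proof. by rewrite /cinner -big_split /=; apply: eq_bigr => i _; rewrite mxE mulrDl. Qed.

Lemma cinnerZl c x y : cinner (c *: x) y = c * cinner x y.
Proof. by rewrite /cinner mulr_sumr; apply: eq_bigr => i _; rewrite mxE mulrA. Qed.

Lemma cinnerDr x y (z : 'cV[C]_n) : cinner x (y + z) = cinner x y + cinner x z.
Proof. by rewrite cinnerC cinnerDl rmorphD /= -!cinnerC. Qed.

Lemma cinnerZr c x y : cinner x (c *: y) = c^* * cinner x y.
Proof. by rewrite cinnerC cinnerZl rmorphM /= -cinnerC. Qed.

Lemma cinner_self x : cinner x x = (vnorm x ^+ 2)%:C%C.
Proof.
rewrite vnorm_sqr raddf_sum /=; apply: eq_bigr => i _.
exact: mulc_conj.
Qed.

(** Cauchy-Schwarz up to a factor [n], by bounding each coordinate by the norm; a constant depending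
    on the dimension is harmless in what follows. *)
Lemma cmod_cinner_le x y : cmod (cinner x y) <= n%:R * (vnorm x * vnorm y).
Proof.
rewrite /cinner (le_trans (cmod_sum _ _ _)) //.
rewrite mulr_natl -[X in _ *+ X]card_ord -sumr_const; apply: ler_sum => i _.
by rewrite cmodM cmod_conj ler_pM ?cmod_ge0 ?cmod_coord_le.
Qed.

End Vectors.

Section Operators.
Variable n : nat.
Implicit Types A B : 'M[C]_n.+1.

(** Makes the set defining [opnorm] bounded above, so that its [sup] is a genuine supremum rather
    than a default value. *)
Lemma vnorm_mulmx_bounded A : exists c, forall x, vnorm (A *m x) <= c * vnorm x.
Proof.
exists (\sum_j vnorm (col j A)) => x.
have -> : A *m x = \sum_j x j 0 *: col j A.
  apply/matrixP => i k; rewrite ord1 summxE mxE.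
  by apply: eq_bigr => j _; rewrite !mxE mulrC.
rewrite mulr_suml.
apply: (@le_trans _ _ (\sum_j vnorm (x j 0 *: col j A))).
  elim/big_rec2: _ => [|i u v _ le]; first by rewrite vnorm0.
  by rewrite (le_trans (vnormD _ _)) // lerD2l.
apply: ler_sum => j _; rewrite vnormZ mulrC.
by rewrite ler_wpM2l ?vnorm_ge0 ?cmod_coord_le.
Qed.

Lemma vnorm_delta : vnorm (delta_mx 0 0 : 'cV[C]_n.+1) = 1.
Proof.
rewrite /vnorm (bigD1 ord0) //= big1 ?addr0 => [|i i0]; rewrite !mxE eqxx.
  by rewrite cmod1 expr1n sqrtr1.
by rewrite (negPf i0) cmod0 expr0n.
Qed.

Lemma opnormP A x : vnorm (A *m x) <= opnorm A * vnorm x.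
Proof.
have [->|x0] := eqVneq x 0; first by rewrite mulmx0 vnorm0 mulr0.
have x_gt0 : 0 < vnorm x by rewrite lt_neqAle vnorm_ge0 eq_sym vnorm_eq0 x0.
rewrite -ler_pdivrMr // mulrC.
have -> : (vnorm x)^-1 * vnorm (A *m x) = vnorm (A *m ((vnorm x)^-1%:C%C *: x)).
  by rewrite -scalemxAr vnormZ cmod_realp ?invr_ge0 ?vnorm_ge0.
apply: ub_le_sup; last by exists ((vnorm x)^-1%:C%C *: x) => //; exact: vnorm_normalize.
have [c cP] := vnorm_mulmx_bounded A.
by exists c => _ [y /= y1 <-]; rewrite -(mulr1 c) -y1.
Qed.

Lemma opnorm_le A c : (forall x, vnorm x = 1 -> vnorm (A *m x) <= c) -> opnorm A <= c.
Proof.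
move=> le; apply: ge_sup => [|_ [x /= x1 <-]]; last exact: le.
by exists (vnorm (A *m delta_mx 0 0)), (delta_mx 0 0) => //=; exact: vnorm_delta.
Qed.

Lemma opnorm_ge0 A : 0 <= opnorm A.
Proof.
by apply: le_trans (vnorm_ge0 (A *m delta_mx 0 0)) _; rewrite -[leRHS]mulr1 -vnorm_delta opnormP.
Qed.

Lemma opnormD A B : opnorm (A + B) <= opnorm A + opnorm B.
Proof.
apply: opnorm_le => x x1; rewrite mulmxDl (le_trans (vnormD _ _)) //.
by rewrite lerD // -[leRHS]mulr1 -x1 opnormP.
Qed.

Lemma opnormM A B : opnorm (A * B) <= opnorm A * opnorm B.
Proof.
apply: opnorm_le => x x1; rewrite -mulmxE -mulmxA (le_trans (opnormP _ _)) //.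
by rewrite ler_wpM2l ?opnorm_ge0 // -[leRHS]mulr1 -x1 opnormP.
Qed.

Lemma opnormM_le A B (a b : R) : opnorm A <= a -> opnorm B <= b ->
  opnorm (A * B) <= a * b.
Proof. by move=> Aa Bb; rewrite (le_trans (opnormM _ _)) // ler_pM ?opnorm_ge0. Qed.

Lemma opnormN A : opnorm (- A) = opnorm A.
Proof.
rewrite /opnorm; congr sup; apply/seteqP; split => _ [x /= x1 <-];
  by exists x; rewrite //= mulNmx vnormN.
Qed.

Lemma opnormB A B : opnorm (A - B) <= opnorm A + opnorm B.
Proof. by rewrite -(opnormN B) opnormD. Qed.

Lemma opnormZ c A : opnorm (c *: A) <= cmod c * opnorm A.
Proof.
apply: opnorm_le => x x1; rewrite -scalemxAl vnormZ.
by rewrite ler_wpM2l ?cmod_ge0 // -[leRHS]mulr1 -x1 opnormP.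
Qed.

Lemma opnorm_scalar c : opnorm (c%:M : 'M[C]_n.+1) <= cmod c.
Proof. by apply: opnorm_le => x x1; rewrite mul_scalar_mx vnormZ x1 mulr1. Qed.

Lemma opnorm0 : opnorm (0 : 'M[C]_n.+1) = 0.
Proof.
by apply/eqP; rewrite eq_le opnorm_ge0 andbT opnorm_le // => x _; rewrite mul0mx vnorm0.
Qed.

End Operators.
End Norms.

(** * Numerical range: convexity, and stability of its discs under perturbation *)

Section NumericalRange.
Variable R : realType.
Local Notation C := R[i].
Variable n : nat.
Implicit Types (A B : 'M[C]_n.+1) (x y : 'cV[C]_n.+1).

Lemma exists_phase (w : C) : exists2 u : C, cmod u = 1 & complex.Im (u * w) = 0.
Proof.
have [->|w0] := eqVneq w 0; first by exists 1; rewrite ?mulr0 ?cmod1.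
have m0 : cmod w != 0 by rewrite cmod_eq0.
exists ((cmod w)^-1%:C%C * w^*).
  by rewrite cmodM cmod_conj cmod_realp ?invr_ge0 ?cmod_ge0 // mulVf.
by rewrite -mulrA [w^* * w]mulrC mulc_conj -rmorphM.
Qed.

Lemma quad_interpolate B x y (u : C) (s : R) : cmod u = 1 ->
  let z := (1 - s)%:C%C *: x + (s%:C%C * u) *: y in
  cinner (B *m z) z = ((1 - s) ^+ 2)%:C%C * cinner (B *m x) x
    + (s ^+ 2)%:C%C * cinner (B *m y) y
    + (s * (1 - s))%:C%C * (u^* * cinner (B *m x) y + u * cinner (B *m y) x).
Proof.
move=> u1 /=.
have uu : u * u^* = 1 by rewrite mulc_conj u1 expr1n.
have conjR (r : R) : (r%:C%C)^* = r%:C%C :> C by exact: conjc_real.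
rewrite mulmxDr -!scalemxAr !cinnerDl !cinnerDr !cinnerZl !cinnerZr.
rewrite !rmorphM /= !conjR ?rmorphXn ?rmorphM /=.
have -> : s%:C%C ^+ 2 * cinner (B *m y) y
    = s%:C%C ^+ 2 * (u * u^*) * cinner (B *m y) y by rewrite uu mulr1.
ring.
Qed.

Lemma quad_zero B x y (a b : R) :
  vnorm x = 1 -> vnorm y = 1 ->
  cinner (B *m x) x = a%:C%C -> cinner (B *m y) y = b%:C%C ->
  a <= 0 -> 0 <= b -> a < b ->
  exists2 z, z != 0 & cinner (B *m z) z = 0.
Proof.
move=> x1 y1 Bx By a0 b0 ab.
(* This phase makes the cross term [v] real: conjugating the first summand of [v] changes the sign
   of its imaginary part, so [v] has the imaginary part of [u] times this difference. *)
have [u u1 uIm] := exists_phase (cinner (B *m y) x - (cinner (B *m x) y)^*).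
set v := u^* * cinner (B *m x) y + u * cinner (B *m y) x.
have vR : v = (complex.Re v)%:C%C.
  have : complex.Im v = 0.
    rewrite -uIm /v; case: (cinner (B *m x) y) => p q.
    case: (cinner (B *m y) x) => p' q'; case: {v uIm u1} u => r s /=; ring.
  by case: v => r s /= ->.
set g := complex.Re v in vR.
pose p : {poly R} := (1 - 'X) ^+ 2 * a%:P + 'X ^+ 2 * b%:P + 'X * (1 - 'X) * g%:P.
have pE s : p.[s] = (1 - s) ^+ 2 * a + s ^+ 2 * b + s * (1 - s) * g.
  by rewrite /p !hornerE.
have p01 : p.[0] <= 0 <= p.[1].
  rewrite !pE; apply/andP; split; lra.
have [s /andP[s0 s1] /rootP] := poly_ivt ler01 p01.
rewrite pE => ps.
exists ((1 - s)%:C%C *: x + (s%:C%C * u) *: y); last first.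
  by rewrite quad_interpolate // -/v vR Bx By -!rmorphM -!rmorphD /= ps.
(* If the vector vanished, comparing norms would give [s = 1/2]; then [x] and [y] differ by a phase,
   the form agrees on them, and [a = b]. *)
apply/negP => /eqP z0.
have xy : (1 - s)%:C%C *: x = - ((s%:C%C * u) *: y) by apply/eqP; rewrite -addr_eq0 z0.
have ss : 1 - s = s.
  have := congr1 (@vnorm R n.+1) xy.
  rewrite vnormN !vnormZ x1 y1 cmodM u1 !cmod_realp ?subr_ge0 //; lra.
have := congr1 (fun z => cinner (B *m z) z) xy.
rewrite /= -scaleNr -!scalemxAr !cinnerZl !cinnerZr Bx By.
rewrite !mulrA -![_ * _^*]/(_ * _) !mulc_conj cmodN cmodM u1 mulr1 !cmod_realp ?subr_ge0 //.
rewrite -!rmorphM /= => /complexI; rewrite ss => /mulfI eqab.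
have s2 : s ^+ 2 != 0 by rewrite sqrf_eq0; apply/eqP; lra.
by move: ab; rewrite (eqab s2) ltxx.
Qed.

Lemma numrangeP A (m : C) z : z != 0 ->
  cinner (A *m z) z = m * (vnorm z ^+ 2)%:C%C -> numrange A m.
Proof.
move=> z0 Az; exists ((vnorm z)^-1%:C%C *: z); split; first exact: vnorm_normalize.
rewrite -scalemxAr cinnerZl cinnerZr Az mulrA mulc_conj mulrCA -rmorphM.
rewrite cmod_realp ?invr_ge0 ?vnorm_ge0 // -exprMn mulVf ?vnorm_eq0 //.
by rewrite expr1n mulr1.
Qed.

(* Toeplitz-Hausdorff: an affine change of [A] sends [a] to [- t] and [b] to
   [1 - t], and then a zero of the quadratic form is found by the intermediate
   value theorem on a real segment joining [x] to a rotation of [y]. *)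
Theorem numrange_convex A (a b : C) (t : R) :
  numrange A a -> numrange A b -> 0 <= t -> t <= 1 ->
  numrange A ((1 - t)%:C%C * a + t%:C%C * b).
Proof.
move=> Wa Wb t0 t1.
have [ab|ab] := eqVneq a b.
  by rewrite -ab -mulrDl -rmorphD /= subrK mul1r.
case: Wa => x [x1 ax]; case: Wb => y [y1 bx].
set m := _ + _.
have d0 : b - a != 0 by rewrite subr_eq0 eq_sym.
pose B := (b - a)^-1 *: (A - m%:M).
have BE z : cinner (B *m z) z
    = (b - a)^-1 * (cinner (A *m z) z - m * (vnorm z ^+ 2)%:C%C).
  rewrite /B -scalemxAl cinnerZl mulmxBl mul_scalar_mx -scaleNr.
  by rewrite cinnerDl cinnerZl cinner_self mulNr.
have am : a - m = (- t)%:C%C * (b - a) by rewrite /m rmorphN rmorphB /=; ring.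
have bm : b - m = (1 - t)%:C%C * (b - a) by rewrite /m rmorphB /=; ring.
have Bx : cinner (B *m x) x = (- t)%:C%C.
  by rewrite BE x1 expr1n mulr1 -ax am mulrC mulfK.
have By : cinner (B *m y) y = (1 - t)%:C%C.
  by rewrite BE y1 expr1n mulr1 -bx bm mulrC mulfK.
have [|||z z0 /eqP] := quad_zero x1 y1 Bx By; [lra..|].
 rewrite BE mulf_eq0 invr_eq0 (negPf d0) /= subr_eq0 => /eqP.
exact: numrangeP.
Qed.

Lemma numrange_perturb A B (a : C) : numrange A a ->
  exists2 b, numrange B b & cmod (b - a) <= n.+1%:R * opnorm (B - A).
Proof.
move=> [x [x1 ->]]; exists (cinner (B *m x) x); first by exists x.
have -> : cinner (B *m x) x - cinner (A *m x) x = cinner ((B - A) *m x) x.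
  by rewrite mulmxBl cinnerDl -[- (A *m x)]scaleN1r cinnerZl mulN1r.
rewrite (le_trans (cmod_cinner_le _ _)) // x1 mulr1 ler_wpM2l ?ler0n //.
by rewrite -[leRHS]mulr1 -x1 opnormP.
Qed.

(* The weights are the oriented areas of the triangles spanned by [0] and two of
   the three points. *)
Lemma triangle_weights (s x1 y1 x2 y2 x3 y3 : R) : 0 < s ->
  `|x1 - s| <= s / 10 -> `|y1| <= s / 10 ->
  `|x2 + s| <= s / 10 -> `|y2 - s| <= s / 10 ->
  `|x3 + s| <= s / 10 -> `|y3 + s| <= s / 10 ->
  exists t1 t2 t3 : R, [/\ 0 < t1, 0 < t2, 0 < t3,
    t1 * x1 + t2 * x2 + t3 * x3 = 0 & t1 * y1 + t2 * y2 + t3 * y3 = 0].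
Proof.
move=> s0; rewrite !ler_norml.
move=> /andP[a1 a2] /andP[b1 b2] /andP[c1 c2] /andP[d1 d2] /andP[e1 e2] /andP[f1 f2].
exists (x2 * y3 - y2 * x3), (x3 * y1 - y3 * x1), (x1 * y2 - y1 * x2).
split; [nra|nra|nra|ring|ring].
Qed.

(* Three points of a disc in [W(A)] are close to points of [W(B)] whose triangle
   still contains the centre. *)
Lemma numrange_disc A B (c : C) (e : R) : 0 < e ->
  (forall w, cmod (w - c) < e -> numrange A w) ->
  20 * (n.+1%:R * opnorm (B - A)) <= e -> numrange B c.
Proof.
move=> e0 disc small.
(* With [e = 2 s], a displacement of coordinates at most [s] has length at most [sqrt 2 * s < e],
   and the perturbation bound [e / 20] is the tolerance [s / 10] of [triangle_weights]. *)
have [s s0 es] : exists2 s, 0 < s & e = s * 2.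
  by exists (e / 2); [rewrite divr_gt0|rewrite mulfVK].
have near (p q : R) : `|p| <= 1 -> `|q| <= 1 ->
    exists2 b, numrange B b &
      `|complex.Re (b - c) - s * p| <= s / 10 /\ `|complex.Im (b - c) - s * q| <= s / 10.
  move=> p1 q1; pose d := Complex (s * p) (s * q).
  have dc : cmod (c + d - c) < e.
    rewrite addrC addKr -(@ltr_pXn2r _ 2) ?nnegrE ?cmod_ge0 ?ltW // cmod_sqr /=.
    move: p1 q1; rewrite !ler_norml => /andP[p1 p2] /andP[q1 q2].
    have p2' : p ^+ 2 <= 1 by nra.
    have q2' : q ^+ 2 <= 1 by nra.
    have s2 := exprn_gt0 2 s0; rewrite es !exprMn.
    have : s ^+ 2 * p ^+ 2 <= s ^+ 2 by rewrite ger_pMr.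
    have : s ^+ 2 * q ^+ 2 <= s ^+ 2 by rewrite ger_pMr.
    by lra.
  have [b Wb bd] := numrange_perturb B (disc _ dc).
  have bd' : cmod (b - (c + d)) <= s / 10 by lra.
  exists b => //; split.
    rewrite (_ : _ - _ = complex.Re (b - (c + d))) ?(le_trans (cmod_Re _)) //.
    by rewrite opprD addrA; case: (b - c).
  rewrite (_ : _ - _ = complex.Im (b - (c + d))) ?(le_trans (cmod_Im _)) //.
  by rewrite opprD addrA; case: (b - c).
have [||b1 W1 [r1 i1]] := near 1 0; [by rewrite normr1|by rewrite normr0|].
have [||b2 W2 [r2 i2]] := near (-1) 1; [by rewrite normrN1|by rewrite normr1|].
have [||b3 W3 [r3 i3]] := near (-1) (-1); [by rewrite normrN1|by rewrite normrN1|].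
move: r1 i1 r2 i2 r3 i3; rewrite !(mulr1, mulr0, mulrN1, opprK, subr0).
move=> r1 i1 r2 i2 r3 i3.
have [t1 [t2 [t3 [t1p t2p t3p tx ty]]]] := triangle_weights s0 r1 i1 r2 i2 r3 i3.
(* Convexity is applied twice: [u] lies on the side from [b1] to [b2], and [c] lies between [u] and
   [b3]. *)
pose u := (1 - t2 / (t1 + t2))%:C%C * b1 + (t2 / (t1 + t2))%:C%C * b2.
have Wu : numrange B u.
  apply: numrange_convex => //; first by rewrite divr_ge0 ?addr_ge0 ?ltW.
  by rewrite ler_pdivrMr ?addr_gt0 // mul1r lerDr ltW.
suff -> : c = (1 - t3 / (t1 + t2 + t3))%:C%C * u + (t3 / (t1 + t2 + t3))%:C%C * b3.
  apply: numrange_convex => //; first by rewrite divr_ge0 ?addr_ge0 ?ltW.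
  by rewrite ler_pdivrMr ?addr_gt0 // mul1r lerDr addr_ge0 ?ltW.
move: tx ty; rewrite /u; case: b1 {W1 r1 i1 Wu u} => x1 y1.
case: b2 {W2 r2 i2} => x2 y2; case: b3 {W3 r3 i3} => x3 y3.
case: {disc near} c => c1 c2 /= tx ty.
have S0 : t1 + t2 + t3 != 0 by rewrite gt_eqF ?addr_gt0.
have T0 : t1 + t2 != 0 by rewrite gt_eqF ?addr_gt0.
apply/eqP; rewrite eq_complex /=; apply/andP; split; apply/eqP.
  apply: (mulfI S0); transitivity (t1 * x1 + t2 * x2 + t3 * x3); first by lra.
  by field; rewrite S0.
apply: (mulfI S0); transitivity (t1 * y1 + t2 * y2 + t3 * y3); first by lra.
by field; rewrite S0.
Qed.

End NumericalRange.

(** * Roots of unity and elementary estimates *)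

Lemma prim_root_exists (F : numClosedFieldType) (m : nat) :
  (0 < m)%N -> exists z : F, m.-primitive_root z.
Proof.
move=> m_gt0; have [rs] := closed_field_poly_normal ('X^m - 1 : {poly F}).
rewrite lead_coefXnsubC // scale1r => Dp.
have /hasP[z _ zP] : has m.-primitive_root rs; last by exists z.
apply: has_prim_root => //.
- by apply/allP => z; rewrite -root_prod_XsubC -Dp.
- by rewrite -separable_prod_XsubC -Dp separable_Xn_sub_1 // pnatr_eq0 -lt0n.
- by rewrite -ltnS -(size_prod_XsubC rs id) -Dp size_XnsubC.
Qed.

Lemma sum_geometric_root (F : fieldType) (m : nat) (x : F) :
  x ^+ m = 1 -> x != 1 -> \sum_(j < m) x ^+ j = 0.
Proof.
move=> xm x1; apply/eqP; have /eqP := subrX1 x m.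
by rewrite xm subrr eq_sym mulf_eq0 subr_eq0 (negPf x1).
Qed.

Lemma bernoulli_ineq (F : realFieldType) (x : F) (k : nat) :
  0 <= x -> 1 + k%:R * x <= (1 + x) ^+ k.
Proof.
move=> x0; elim: k => [|k IH]; first by rewrite mul0r addr0.
rewrite exprS; apply: le_trans (ler_wpM2l _ IH); last by rewrite addr_ge0.
have : 0 <= k%:R * x ^+ 2 by rewrite mulr_ge0 ?sqr_ge0.
rewrite -natr1; nra.
Qed.

(** If [a > K > 0], Bernoulli's inequality makes the powers of [a / K] grow at least linearly, past
    any constant [c]. *)
Lemma le_of_powers_bounded (F : archiRealFieldType) (a K c : F) : 0 <= a -> 0 <= K ->
  (forall k, a ^+ k <= c * K ^+ k) -> a <= K.
Proof.
move=> a0 K0 le; rewrite leNgt; apply/negP => Ka.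
have [K_eq|K_neq] := eqVneq K 0.
  by have := le 1%N; rewrite !expr1 K_eq mulr0 leNgt -K_eq Ka.
have K_gt0 : 0 < K by rewrite lt_neqAle eq_sym K_neq.
pose d := a / K - 1.
have d0 : 0 < d by rewrite subr_gt0 ltr_pdivlMr ?mul1r.
have ck k : k%:R * d <= c.
  apply: (@le_trans _ _ ((1 + d) ^+ k)).
    by rewrite (le_trans _ (bernoulli_ineq _ (ltW d0))) // lerDr.
  by rewrite addrC subrK expr_div_n ler_pdivrMr ?exprn_gt0.
have := archi_boundP (divr_ge0 (le_trans _ (ck 0%N)) (ltW d0)).
rewrite mul0r => /(_ (lexx 0)).
by rewrite ltr_pdivrMr // ltNge ck.
Qed.

(** * Maximum principle for polynomials on discs *)

Section MaximumModulus.
Variable R : realType.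
Local Notation C := R[i].
Implicit Types (p : {poly C}) (z w : C).

(* Cauchy's estimate, with the circle average replaced by the average over roots
   of unity of an order exceeding the degree. *)
Lemma cauchy_coef p (rho K : R) (k : nat) : 0 <= rho ->
  (forall z, cmod z = rho -> cmod p.[z] <= K) -> cmod p`_k * rho ^+ k <= K.
Proof.
move=> rho0 le; pose m := maxn (size p) k.+1.
have pm : (size p <= m)%N by rewrite leq_maxl.
have km : (k < m)%N by rewrite leq_maxr.
have m_gt0 : (0 < m)%N := leq_ltn_trans (leq0n k) km.
have [u uP] := prim_root_exists C m_gt0.
have u1 : cmod u = 1.
  apply/eqP; rewrite -(@eqrXn2 _ m) ?cmod_ge0 ?ler01 // -cmodX.
  by rewrite (prim_expr_order uP) cmod1 expr1n.
(* The weight is the inverse of [u ^+ (j * k)], written with a natural exponent; the sum is a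
   discrete Fourier transform isolating the coefficient of index [k]. *)
have avg : \sum_(j < m) u ^+ (j * (m - k)) * p.[rho%:C%C * u ^+ j]
    = m%:R * (p`_k * rho%:C%C ^+ k).
  under eq_bigr => j _ do rewrite (horner_coef_wide _ pm) mulr_sumr.
  rewrite exchange_big /= (bigD1 (Ordinal km)) //= [X in _ + X]big1 ?addr0.
    rewrite mulr_natl -[X in _ *+ X]card_ord -sumr_const; apply: eq_bigr => j _.
    rewrite exprMn -exprM mulrCA; congr (_ * _); rewrite mulrCA -exprD -mulnDr.
    by rewrite subnK 1?ltnW // mulnC exprM (prim_expr_order uP) expr1n mulr1.
  move=> i ik.
  transitivity (p`_i * rho%:C%C ^+ i * \sum_(j < m) (u ^+ (m - k + i)) ^+ j).
    rewrite mulr_sumr; apply: eq_bigr => j _.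
    by rewrite exprMn -!exprM mulrCA -mulrA; congr (_ * _);
      rewrite mulrCA -exprD -mulnDr [(j * _)%N]mulnC.
  rewrite sum_geometric_root ?mulr0 //.
    by rewrite -exprM mulnC exprM (prim_expr_order uP) expr1n.
  (* If the ratio were [1], [m] would divide [m - k + i], which lies strictly between [0] and [2 m];
     it would equal [m], so [i = k]. *)
  rewrite -(prim_order_dvd uP); apply: contra ik => /dvdnP[q qE].
  apply/eqP/val_inj => /=.
  have im := ltn_ord i; have : q = 1%N by nia.
  by move=> q1; lia.
have : cmod (m%:R * (p`_k * rho%:C%C ^+ k)) <= m%:R * K.
  rewrite -avg (le_trans (cmod_sum _ _ _)) //.
  rewrite mulr_natl -[X in _ *+ X]card_ord -sumr_const; apply: ler_sum => j _.
  rewrite cmodM cmodX u1 expr1n mul1r le // cmodM cmodX u1 expr1n mulr1.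
  exact: cmod_realp.
have -> : (m%:R : C) = (m%:R : R)%:C%C by rewrite rmorph_nat.
rewrite !cmodM cmodX !cmod_realp ?ler0n // ler_pM2l ?ltr0n //.
Qed.

Lemma geometric_le (t : R) (m : nat) : 0 <= t -> t < 1 ->
  \sum_(i < m) t ^+ i <= (1 - t)^-1.
Proof.
move=> t0 t1; have t1' : 0 < 1 - t by rewrite subr_gt0.
rewrite -[leRHS]mul1r ler_pdivlMr // mulrC -opprB mulNr -subrX1 opprB.
by rewrite lerBlDr lerDl exprn_ge0.
Qed.

(** Cauchy's estimate bounds the terms of [p] at [w] by those of a geometric series of ratio
    [cmod w / rho], whence the extra factor. *)
Lemma max_modulus_weak p (rho K : R) w :
  (forall z, cmod z = rho -> cmod p.[z] <= K) -> cmod w < rho ->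
  cmod p.[w] <= (1 - cmod w / rho)^-1 * K.
Proof.
move=> le wr; have rho0 : 0 < rho := le_lt_trans (cmod_ge0 w) wr.
have t1 : cmod w / rho < 1 by rewrite ltr_pdivrMr ?mul1r.
have t0 : 0 <= cmod w / rho by rewrite divr_ge0 ?cmod_ge0 ?ltW.
have K0 : 0 <= K.
  by rewrite (le_trans (cmod_ge0 p.[rho%:C%C])) // le // cmod_realp ?ltW.
rewrite horner_coef (le_trans (cmod_sum _ _ _)) //.
apply: le_trans (ler_wpM2r K0 (geometric_le (size p) t0 t1)).
rewrite mulr_suml; apply: ler_sum => i _.
rewrite cmodM cmodX expr_div_n -mulrA mulrC ler_wpM2l ?exprn_ge0 ?cmod_ge0 //.
by rewrite mulrC ler_pdivlMr ?exprn_gt0 // cauchy_coef // ltW.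
Qed.

(* Landau's trick: applying the weak bound to the powers of [p] removes the
   constant. *)
Lemma max_modulus p (l : C) (rho K : R) w :
  (forall z, cmod (z - l) = rho -> cmod p.[z] <= K) -> cmod (w - l) <= rho ->
  cmod p.[w] <= K.
Proof.
move=> le; rewrite le_eqVlt => /orP[/eqP/le//|wr].
have rho0 : 0 < rho := le_lt_trans (cmod_ge0 _) wr.
have K0 : 0 <= K.
  rewrite (le_trans (cmod_ge0 p.[l + rho%:C%C])) // le // addrC addKr.
  by rewrite cmod_realp ?ltW.
apply: (@le_of_powers_bounded _ _ _ (1 - cmod (w - l) / rho)^-1) => //.
  exact: cmod_ge0.
move=> k; rewrite -cmodX.
have -> : p.[w] ^+ k = ((p \Po ('X + l%:P)) ^+ k).[w - l].
  by rewrite horner_exp horner_comp !hornerE subrK.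
apply: max_modulus_weak wr => z zr.
rewrite horner_exp horner_comp !hornerE cmodX lerXn2r ?nnegrE ?cmod_ge0 //.
by rewrite le // addrK.
Qed.

End MaximumModulus.

(** Discrete Leibniz rule without commutativity, for one step of Horner's scheme evaluated at two
    matrices. *)
Lemma mulr_increment (T : pzRingType) (u v x y w : T) :
  u * x + w - (v * y + w) = (u - v) * x + v * (x - y).
Proof. by rewrite opprD addrACA subrr addr0 mulrBl mulrBr addrA subrK. Qed.

(** * Matrix values of polynomials bounded near the spectrum *)

Section PolynomialsNearSpectrum.
Variable R : realType.
Local Notation C := R[i].
Implicit Types (p q r : {poly C}) (L : seq C) (rho M : R).

Definition disc_union L rho : set C :=
  [set z | exists2 l, l \in L & cmod (z - l) <= rho].

Definition bounded_on (U : set C) M p := forall z, U z -> cmod p.[z] <= M.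

(** At distance at least [rho] from [l], dividing [p - p(l)] by [X - l] costs a factor [2 / rho].
    Nearer to [l], the maximum principle transfers the bound from the circle of radius [rho], which
    lies in the union. *)
Lemma division_bounded L rho (l : C) p M : 0 < rho -> l \in L ->
  bounded_on (disc_union L rho) M p ->
  exists q, [/\ p = q * ('X - l%:P) + p.[l]%:P, (size q <= (size p).-1)%N &
    bounded_on (disc_union L rho) (2 / rho * M) q].
Proof.
move=> rho0 lL bp.
have Ul : disc_union L rho l by exists l; rewrite // subrr cmod0 ltW.
have : root (p - p.[l]%:P) l by rewrite /root !hornerE subrr.
move=> /factor_theorem[q qE]; exists q.
have pE : p = q * ('X - l%:P) + p.[l]%:P by rewrite -qE subrK.
have outside z : disc_union L rho z -> rho <= cmod (z - l) -> cmod q.[z] <= 2 / rho * M.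
  move=> Uz zl; have zl0 := lt_le_trans rho0 zl.
  have : cmod q.[z] * cmod (z - l) <= 2 * M.
    rewrite -cmodM.
    have -> : q.[z] * (z - l) = p.[z] - p.[l].
      by rewrite {1}pE !hornerE addrK.
    by rewrite (le_trans (cmodB _ _)) // mulr2n mulrDl mul1r lerD // bp.
  rewrite mulrAC ler_pdivlMr //; apply: le_trans.
  by rewrite ler_wpM2l ?cmod_ge0.
split=> //.
  have [->|q0] := eqVneq q 0; first by rewrite size_poly0.
  have := size_polyD p (- p.[l]%:P).
  rewrite qE size_Mmonic ?monicXsubC // size_XsubC addn2 /= size_polyN.
  have := size_polyC_leq1 p.[l].
  have : (0 < size p)%N.
    rewrite lt0n size_poly_eq0; apply: contra_neq q0 => p0.
    move: qE; rewrite p0 horner0 subr0 => /esym/eqP.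
    by rewrite mulf_eq0 polyXsubC_eq0 orbF => /eqP.
  move=> p0 c1; rewrite leq_max -(ltn_predK p0) ltnS => /orP[//|qc].
  by rewrite (leq_trans _ (leq0n _)) // -ltnS (leq_trans qc).
move=> z Uz; have [|lt] := leP rho (cmod (z - l)); first exact: outside.
apply: max_modulus (ltW lt) => w wl; apply: outside; rewrite ?wl //.
by exists l; rewrite ?wl.
Qed.

Local Opaque opnorm.

Section Matrices.
Variables (n : nat) (A : 'M[C]_n.+1).
Implicit Type B : 'M[C]_n.+1.

Lemma opnorm_near B : opnorm (B - A) <= 1 -> opnorm B <= opnorm A + 1.
Proof.
move=> BA; rewrite -[in leLHS](subrK A B) (le_trans (opnormD _ _)) //.
by rewrite [leRHS]addrC lerD2r.
Qed.

(** Here the constant depends on [p]; the estimate is applied to a single fixed polynomial that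
    annihilates [A]. *)
Lemma horner_mx_lipschitz p : exists2 c : R, 0 <= c &
  forall B, opnorm (B - A) <= 1 ->
    opnorm (horner_mx B p - horner_mx A p) <= c * opnorm (B - A).
Proof.
elim/poly_ind: p => [|p a [c c0 IH]].
  by exists 0 => // B _; rewrite !rmorph0 subrr opnorm0 mul0r.
exists (c * (opnorm A + 1) + opnorm (horner_mx A p)).
  by rewrite addr_ge0 ?mulr_ge0 ?addr_ge0 ?opnorm_ge0.
move=> B BA; rewrite !rmorphD !rmorphM /= !horner_mx_X !horner_mx_C.
rewrite (mulr_increment (horner_mx B p) (horner_mx A p) B A).
apply: le_trans (opnormD _ _) _; rewrite [leRHS]mulrDl.
apply: lerD; last exact: opnormM.
by rewrite [leRHS]mulrAC; apply: opnormM_le; [exact: IH|exact: opnorm_near].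
Qed.

(** The point is that [c] is independent of [p] and [M]. The remainder is controlled at matrices
    near [A], while the quotient is again bounded on the discs and of smaller size, so the division
    can be iterated. *)
Lemma newton_interpolation L rho Ls : 0 < rho -> {subset Ls <= L} ->
  exists2 c : R, 0 <= c & forall p M, 0 <= M ->
    bounded_on (disc_union L rho) M p -> exists r q,
    [/\ p = r + q * \prod_(l <- Ls) ('X - l%:P),
        (size q <= size p - size Ls)%N,
        bounded_on (disc_union L rho) (c * M) q &
        forall B, opnorm (B - A) <= 1 -> opnorm (horner_mx B r) <= c * M /\
          opnorm (horner_mx B r - horner_mx A r) <= c * M * opnorm (B - A)].
Proof.
move=> rho0; elim: Ls => [|l Ls IH] sub.
  exists 1 => // p M M0 bp; exists 0, p; split.
  - by rewrite big_nil mulr1 add0r.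
  - by rewrite subn0.
  - by rewrite mul1r.
  - move=> B _; rewrite !rmorph0 subrr opnorm0 mul1r; split=> //.
    by rewrite mulr_ge0 ?opnorm_ge0.
have [|c c0 {}IH] := IH; first by move=> x xLs; rewrite sub // inE xLs orbT.
have lL : l \in L by rewrite sub // inE eqxx.
set k := 2 / rho; have k0 : 0 <= k by rewrite divr_ge0 ?ltW.
set b := opnorm A + 1 + cmod l.
have b0 : 0 <= b by rewrite !addr_ge0 ?opnorm_ge0 ?cmod_ge0.
have ck0 : 0 <= c * k by rewrite mulr_ge0.
(* One constant covers three bounds: [c k M] for the quotient, [c k M b + M] for the new remainder,
   and [c k M (b + 1)] for its Lipschitz constant. *)
exists (c * k * (b + 1) + 1); first by rewrite addr_ge0 // mulr_ge0 // addr_ge0.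
move=> p M M0 bp.
have [p1 [pE sp1 bp1]] := division_bounded rho0 lL bp.
have [r [q [p1E sq bq rP]]] := IH p1 (k * M) (mulr_ge0 k0 M0) bp1.
have boundA B : opnorm (B - A) <= 1 -> opnorm (B - l%:M) <= b.
  move=> BA; apply: le_trans (opnormB _ _) _.
  by apply: lerD; [exact: opnorm_near|exact: opnorm_scalar].
have AA : opnorm (A - A) <= 1 by rewrite subrr opnorm0.
have ckM0 : 0 <= c * k * M by rewrite mulr_ge0.
have ckMb0 : 0 <= c * k * M * b by rewrite mulr_ge0.
clearbody b k.
exists (r * ('X - l%:P) + p.[l]%:P), q; split.
- by rewrite big_cons {1}pE p1E; ring.
- by rewrite /= (leq_trans sq) // (leq_trans (leq_sub2r _ sp1)) // -subn1 -subnDA add1n.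
- move=> z Uz; apply: le_trans (bq z Uz) _.
  by rewrite -subr_ge0 (_ : _ - _ = c * k * M * b + M) ?addr_ge0 //; ring.
- move=> B BA; have [rB rBA] := rP B BA.
  rewrite !rmorphD !rmorphM !rmorphB /= !horner_mx_X !horner_mx_C.
  split.
    apply: le_trans (opnormD _ _) _.
    have h1 : opnorm (horner_mx B r * (B - l%:M)) <= c * (k * M) * b.
      exact: opnormM_le rB (boundA _ BA).
    have h2 : opnorm (p.[l]%:M : 'M[C]_n.+1) <= M.
      rewrite (le_trans (opnorm_scalar _ _)) // bp //.
      by exists l; rewrite // subrr cmod0 ltW.
    apply: le_trans (lerD h1 h2) _.
    by rewrite -subr_ge0 (_ : _ - _ = c * k * M) //; ring.
  rewrite (mulr_increment (horner_mx B r) (horner_mx A r) (B - l%:M) (A - l%:M)).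
  set x := B - l%:M.
  have -> : x - (A - l%:M) = B - A by rewrite opprB addrA subrK.
  apply: le_trans (opnormD _ _) _.
  have BA0 := opnorm_ge0 (B - A).
  have h1 := opnormM_le rBA (boundA _ BA : opnorm x <= b).
  have [rA _] : opnorm (horner_mx A r) <= c * (k * M) /\ _ := rP A AA.
  have h2 := opnormM_le rA (lexx (opnorm (B - A))).
  apply: le_trans (lerD h1 h2) _.
  by rewrite -subr_ge0 (_ : _ - _ = M * opnorm (B - A)) ?mulr_ge0 //; ring.
Qed.

(* Iterating the division by the characteristic polynomial gives a geometric
   series in [horner_mx B chi], which is small because [horner_mx A chi = 0]; the
   resulting bounds do not depend on the degree of [p]. *)
Lemma horner_mx_equicontinuous L rho : 0 < rho -> L != [::] ->
  horner_mx A (\prod_(l <- L) ('X - l%:P)) = 0 ->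
  exists k d : R, [/\ 0 <= k, 0 < d & forall p B,
    bounded_on (disc_union L rho) 1 p -> opnorm (B - A) <= d ->
    opnorm (horner_mx B p - horner_mx A p) <= k * opnorm (B - A)].
Proof.
move=> rho0 L0; set chi := \prod_(_ <- _) _ => chiA.
have [c c0 newton] := newton_interpolation rho0 (fun x (xL : x \in L) => xL).
have [e e0 chiP] := horner_mx_lipschitz chi.
have ce0 : 0 <= e * c by rewrite mulr_ge0.
(* Chosen so that [d <= 1] and [d e c <= 1/2], the latter being the ratio of the geometric
   series. *)
pose d := (2 * (e * c) + 1)^-1.
have d0 : 0 < d by rewrite invr_gt0 ltr_wpDl // mulr_ge0.
have d1 : d <= 1 by rewrite invf_le1 ?ltr_wpDl ?mulr_ge0 // lerDr mulr_ge0.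
have dec : d * (e * c) <= 2^-1.
  by rewrite mulrC ler_pdivrMr ?ltr_wpDl ?mulr_ge0 //; lra.
have chiB B : opnorm (B - A) <= d -> opnorm (horner_mx B chi) <= e * opnorm (B - A).
  by move=> Bd; have := chiP B (le_trans Bd d1); rewrite chiA subr0.
(* Since [L] is nonempty the quotient has smaller size, and the induction closes because
   [c M + 2 c (c M) e d <= 2 c M]. *)
have bound B : opnorm (B - A) <= d -> forall m p M, (size p <= m)%N -> 0 <= M ->
    bounded_on (disc_union L rho) M p -> opnorm (horner_mx B p) <= 2 * c * M.
  move=> Bd; elim=> [|m IH] p M.
    rewrite leqn0 size_poly_eq0 => /eqP -> M0 _.
    by rewrite rmorph0 opnorm0 !mulr_ge0.
  move=> sp M0 bp; have [r [q [pE sq bq rP]]] := newton p M M0 bp.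
  have [rB _] := rP B (le_trans Bd d1).
  have sqm : (size q <= m)%N.
    apply: leq_trans sq _; rewrite leq_subLR (leq_trans sp) // -add1n leq_add2r.
    by rewrite lt0n size_eq0.
  have qB := IH q (c * M) sqm (mulr_ge0 c0 M0) bq.
  rewrite pE rmorphD rmorphM /=; apply: le_trans (opnormD _ _) _.
  have h1 : opnorm (horner_mx B q * horner_mx B chi) <= (2 * c * (c * M)) * (e * d).
    apply: opnormM_le qB _.
    by apply: le_trans (chiB _ Bd) _; apply: ler_wpM2l.
  apply: le_trans (lerD rB h1) _.
  rewrite -subr_ge0 (_ : _ - _ = 2 * c * M * (2^-1 - d * (e * c))); last by field.
  by rewrite !mulr_ge0 // subr_ge0.
exists (c + 2 * c * c * e), d; split=> //.
  by rewrite addr_ge0 // !mulr_ge0.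
move=> p B bp Bd; have [r [q [pE sq bq rP]]] := newton p 1 ler01 bp.
have [_ rB] := rP B (le_trans Bd d1).
have qB := bound B Bd (size q) q (c * 1) (leqnn _) (mulr_ge0 c0 ler01) bq.
(* At [A] the quotient term vanishes with [chi]; at [B] it is of order [opnorm (B - A)]. *)
rewrite pE !rmorphD !rmorphM /= -/chi chiA mulr0 addr0 addrAC.
apply: le_trans (opnormD _ _) _.
have h : opnorm (horner_mx B q * horner_mx B chi)
    <= (2 * c * (c * 1)) * (e * opnorm (B - A)).
  exact: opnormM_le qB (chiB _ Bd).
apply: le_trans (lerD rB h) _.
by rewrite (_ : _ + _ = (c + 2 * c * c * e) * opnorm (B - A)) //; ring.
Qed.

Lemma horner_mx_comp p q : horner_mx A (p \Po q) = horner_mx (horner_mx A q) p.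
Proof.
elim/poly_ind: p => [|p a IH]; first by rewrite comp_poly0 !rmorph0.
by rewrite comp_poly_MXaddC !rmorphD !rmorphM /= IH horner_mx_X !horner_mx_C.
Qed.

Lemma char_poly_split : exists L : seq C,
  [/\ L != [::], char_poly A = \prod_(l <- L) ('X - l%:P) &
      forall l, l \in L -> spectrum A l].
Proof.
have [L] := closed_field_poly_normal (char_poly A).
rewrite (monicP (char_poly_monic A)) scale1r => LE; exists L; split=> //.
  apply/negP => /eqP L0; have := size_char_poly A.
  by rewrite LE L0 big_nil size_poly1.
by move=> l lL; rewrite /spectrum /= eigenvalue_root_char LE root_prod_XsubC.
Qed.

End Matrices.

(** The factor [2] leaves a disc of radius [rho] inside [S] around every point of
    [disc_union L rho]. *)
Lemma uniform_radius L (S : set C) : (forall l, l \in L -> cinterior S l) ->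
  exists2 rho : R, 0 < rho &
    forall l, l \in L -> forall w, cmod (w - l) < 2 * rho -> S w.
Proof.
elim: L => [|l L IH] int; first by exists 1.
have [|rho rho0 rhoP] := IH; first by move=> x xL; apply: int; rewrite inE xL orbT.
have [e [e0 eP]] := int l (mem_head _ _).
exists (Num.min rho (e / 2)); first by rewrite lt_min rho0 divr_gt0.
move=> x; rewrite inE => /orP[/eqP ->|xL] w wx.
  apply: eP; apply: lt_le_trans wx _.
  by rewrite mulrC -ler_pdivlMr // ge_min lexx orbT.
apply: (rhoP x xL); apply: lt_le_trans wx _.
by rewrite ler_wpM2l // ge_min lexx.
Qed.

End PolynomialsNearSpectrum.

(** * Upper semicontinuity of the Crouzeix ratio *)

Section UpperSemicontinuity.
Variable R : realType.
Local Notation C := R[i].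
Variables (N : nat) (A : 'M[C]_N.+1).

(* Contracting towards an interior point [z0] moves [W(A)] into [W(B)], so that
   composing an admissible polynomial of [B] with the contraction gives one of
   [A]. *)
Lemma contract_admissible (B : 'M[C]_N.+1) (z0 : C) (t rho : R) (p : {poly C}) :
  0 < t -> t <= 1 -> 0 < rho ->
  (forall w, cmod (w - z0) < rho -> numrange A w) ->
  20 * (N.+1%:R * opnorm (B - A)) <= t * rho ->
  (forall z, numrange B z -> cmod p.[z] <= 1) ->
  ((opnorm (horner_mx ((1 - t)%:C%C *: A + (t%:C%C * z0)%:M) p))%:E
    <= crouzeix_ratio A)%E.
Proof.
move=> t0 t1 rho0 disc small bp.
pose s : {poly C} := (1 - t)%:C%C *: 'X + (t%:C%C * z0)%:P.
have sA : horner_mx A s = (1 - t)%:C%C *: A + (t%:C%C * z0)%:M.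
  by rewrite rmorphD /= horner_mxZ horner_mx_X horner_mx_C.
apply: ereal_sup_ubound; exists (p \Po s) => /=; last by rewrite horner_mx_comp sA.
move=> w Ww; rewrite horner_comp bp // !hornerE.
apply: (numrange_disc (mulr_gt0 t0 rho0) _ small) => v vd.
set c := (_ * w + _) in vd.
have tC : t%:C%C != 0 :> C by rewrite -cmod_eq0 cmod_realp ?ltW // gt_eqF.
(* The disc of radius [t * rho] about the image of [w] is the contraction towards [w] of the disc of
   radius [rho] about [z0], so it lies in the numerical range of [A] by convexity. *)
have -> : v = (1 - t)%:C%C * w + t%:C%C * (z0 + (v - c) / t%:C%C).
  by rewrite mulrDr [_ * (_ / _)]mulrC divfK // addrA -/c [c + _]addrC subrK.
apply: numrange_convex => //; last exact: ltW.
apply: disc; rewrite addrC addKr cmodM cmodV cmod_realp ?ltW //.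
by rewrite ltr_pdivrMr // mulrC.
Qed.

Lemma crouzeix_ratio_usc (eps : R) :
  spectrum A `<=` cinterior (numrange A) -> 0 < eps ->
  exists2 d : R, 0 < d & forall B : 'M[C]_N.+1, opnorm (B - A) <= d ->
    (crouzeix_ratio B <= crouzeix_ratio A + eps%:E)%E.
Proof.
move=> specA eps0.
have [L [L0 chiE specL]] := char_poly_split A.
have [rho rho0 rhoP] := uniform_radius (fun l lL => specA l (specL l lL)).
have chiA := Cayley_Hamilton A; rewrite chiE in chiA.
have [k [d [k0 d0 equi]]] := horner_mx_equicontinuous rho0 L0 chiA.
have [z0 z0L] : exists z0, z0 \in L.
  by case: L L0 {chiE specL rhoP chiA equi} => // z0 L _; exists z0; rewrite mem_head.
have disc0 w : cmod (w - z0) < rho -> numrange A w.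
  by move=> wz; apply: (rhoP z0 z0L); apply: lt_le_trans wz _; lra.
(* Each of the two comparisons with [A] may cost [k * eta <= eps / 2]. *)
pose eta := Num.min d (eps / (2 * (k + 1))).
have k1 : 0 < 2 * (k + 1) by lra.
have eta0 : 0 < eta by rewrite lt_min d0 divr_gt0.
have etad : eta <= d by rewrite ge_min lexx.
have etak : k * eta <= eps / 2.
  have : eta <= eps / (2 * (k + 1)) by rewrite ge_min lexx orbT.
  by rewrite ler_pdivlMr //; lra.
pose D := opnorm (z0%:M - A).
have D1 : 0 < D + 1 by rewrite ltr_wpDl ?opnorm_ge0.
(* The contracted matrix differs from [A] by [t (z0 - A)], of norm at most [t * D <= eta]; [D + 1]
   avoids a zero denominator. *)
pose t := Num.min 1 (eta / (D + 1)).
have t0 : 0 < t by rewrite lt_min ltr01 divr_gt0.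
have t1 : t <= 1 by rewrite ge_min lexx.
have tD : t * D <= eta.
  have : t <= eta / (D + 1) by rewrite ge_min lexx orbT.
  by rewrite ler_pdivlMr //; lra.
have N0 : (0 : R) < 20 * N.+1%:R by rewrite mulr_gt0 ?ltr0n.
exists (Num.min eta (t * rho / (20 * N.+1%:R))).
  by rewrite lt_min eta0 divr_gt0 ?mulr_gt0.
move=> B; rewrite le_min => /andP[Beta]; rewrite ler_pdivlMr // => Bt.
have small : 20 * (N.+1%:R * opnorm (B - A)) <= t * rho by lra.
apply: ge_ereal_sup => _ [p /= bp <-].
(* Around each point of these discs the numerical range of [A] contains a disc of radius [rho], so
   the point itself is in that of [B], where [p] is admissible. *)
have bU : bounded_on (disc_union L rho) 1 p.
  move=> z [l lL zl]; apply: bp; apply: (numrange_disc rho0).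
    move=> w wz; apply: (rhoP l lL).
    rewrite -(subrK z w) -addrA (le_lt_trans (cmodD _ _)) // mulr_natl mulr2n.
    exact: ltr_leD.
  by rewrite (le_trans small) // ler_piMl // ltW.
have psiA := contract_admissible t0 t1 rho0 disc0 small bp.
set A' := _ + _ in psiA.
have A'A : opnorm (A' - A) <= t * D.
  have -> : A' - A = t%:C%C *: (z0%:M - A).
    rewrite /A' rmorphB /= scalerBl scale1r scalerBr scale_scalar_mx.
    by rewrite addrAC [A - _]addrC addrK addrC.
  by apply: le_trans (opnormZ _ _) _; rewrite cmod_realp ?lexx // ltW.
have h1 := equi p B bU (le_trans Beta etad).
have h2 := equi p A' bU (le_trans A'A (le_trans tD etad)).
have h1' : k * opnorm (B - A) <= k * eta by rewrite ler_wpM2l.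
have h2' : k * opnorm (A' - A) <= k * eta by rewrite ler_wpM2l ?(le_trans A'A).
apply: (@le_trans _ _ (opnorm (horner_mx A' p) + eps)%:E); last first.
  by rewrite EFinD leeD2r.
rewrite lee_fin.
have -> : horner_mx B p = (horner_mx B p - horner_mx A p)
    - (horner_mx A' p - horner_mx A p) + horner_mx A' p.
  by rewrite opprB addrA subrK subrK.
apply: le_trans (opnormD _ _) _; rewrite [leRHS]addrC lerD2r.
apply: le_trans (opnormB _ _) _.
apply: le_trans (lerD (le_trans h1 h1') (le_trans h2 h2')) _.
by rewrite [leRHS]splitr; exact: lerD.
Qed.

End UpperSemicontinuity.

(* N >= 1 is encoded by working in dimension N.+1 *)
Theorem theorem2p2 (R : realType) (N : nat) (A : 'M[R[i]]_N.+1)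
    (An : nat -> 'M[R[i]]_N.+1) :
  spectrum A `<=` cinterior (numrange A) ->
  (fun n => opnorm (An n - A)) @ \oo --> (0 : R) ->
  (limn_esup (fun n => crouzeix_ratio (An n)) <= crouzeix_ratio A)%E.
Proof.
move=> specA AnA; apply/lee_addgt0Pr => eps eps0.
have [d d0 dP] := crouzeix_ratio_usc specA eps0.
have near := cvgr0_norm_le _ AnA _ d0.
apply: (@le_trans _ _ (ereal_sup ((fun n => crouzeix_ratio (An n)) @`
  [set n | `|opnorm (An n - A)| <= d]))).
  (* The upper limit is an infimum of suprema over eventual sets of indices, and this set is one of
     them. *)
  by apply: ereal_inf_lbound; exists [set n | `|opnorm (An n - A)| <= d]; [exact: near|].
apply: ge_ereal_sup => _ [n /= nd <-]; apply: dP.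
exact: le_trans (ler_norm _) nd.
Qed.
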